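(* A set of $3$ scattered synchronous agents, each equipped with one pebble, cannot solve PerpExploration-BBH on a ring $R$ with $n$ nodes; that is, no deterministic algorithm for three agents, each initially having one pebble, solves PerpExploration-BBH on all oriented rings and for all scattered initial placements of the agents.
   Context: Model. $R=\{v_0,\dots,v_{n-1}\}$ is a ring with unlabeled nodes; node $v_i$ has two ports, leading to $v_{(i-1)\bmod n}$ and $v_{(i+1)\bmod n}$, consistently labeled left and right. Agents know $n$, have distinct IDs (from $[0,k^c]$, where $k$ is the number of agents and $c$ a constant), have $O(\log n)$ bits of internal memory, and all run the same deterministic algorithm. ''Scattered'' means that the agents start at several distinct nodes (not all at one node). Time proceeds in synchronous rounds; in each round every agent at a node $v$ takes a snapshot (the two ports, the number of pebbles at $v$, its own memory, the IDs of the agents currently at $v$), then performs a communication step and a move step (stay, or move through a port, being at the corresponding neighbour in the next round). Agents crossing the same edge in opposite directions do not notice each other. Pebble model: pebbles are identical movable tokens. In its communication step an agent may pick up pebbles at its current node (in mutual exclusion) or drop pebbles it carries there; carried pebbles move with the agent. The only other communication is that co-located agents see each other's IDs. Byzantine black hole. Exactly one node $v_b$ is a Byzantine black hole; all other nodes are safe; its position is fixed and unknown to the agents, and may be any node that is not a starting node of an agent. At the beginning of each round an adversary (who knows the algorithm) decides whether $v_b$ is active during that round. If active, all agents at $v_b$ in that round are destroyed without trace, and the adversary may additionally choose to destroy the pebbles located at $v_b$. If not active, $v_b$ behaves exactly like a safe node. PerpExploration-BBH: the agents must move so that every node of $R$ except $v_b$ is visited by at least one agent infinitely often. An algorithm solves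 the problem if this holds for every ring size $n$, every scattered initial placement, every admissible position of $v_b$ and every behaviour of the adversary. *)

(* Defs.v *)
From mathcomp Require Import all_boot all_fingroup.

Set Implicit Arguments.
Unset Strict Implicit.
Unset Printing Implicit Defensive.

Definition agent_id (k c : nat) := 'I_(k ^ c).+1.

(* Everything an agent perceives. [lying] does not count the pebbles carried by
   agents, and [present] contains the agent's own identifier. *)
Record view (ID : finType) (m : nat) := View {
  self : ID;
  memory : m.-tuple bool;
  carried : nat;
  lying : nat;
  present : {set ID}
}.

(* [PickUp j] and [Drop j] handle as many pebbles as possible up to [j]; doing
   nothing is [PickUp 0]. *)
Inductive request := PickUp of nat | Drop of nat.

Inductive move := Stay | GoLeft | GoRight.

(* Agents know the ring size [n], which is an argument of every component.
   The last argument of [act] is the number of pebbles the agent carries once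
   its request has been served: this is how it learns whether a pebble it wanted
   was taken by another agent. *)
Record algorithm (k c : nat) := Algorithm {
  bits : nat -> nat;
  bits_logarithmic :
    exists C N, forall n, N <= n -> bits n <= C * trunc_log 2 n;
  init_memory : forall n, (bits n).-tuple bool;
  communicate : forall n, view (agent_id k c) (bits n) -> request;
  act : forall n, view (agent_id k c) (bits n) -> nat ->
          (bits n).-tuple bool * move
}.

(* The behaviour of the Byzantine black hole in one round. *)
Inductive hole_action := Inactive | Active of bool (* destroy the pebbles? *).

Section Execution.

Variables (k c : nat) (A : algorithm k c) (ids : 'I_k -> agent_id k c).
Variable n : nat.

Record agent := Agent {
  loc : 'I_n;
  mem : (bits A n).-tuple bool;
  load : nat
}.

(* A destroyed agent is [None]. *)
Record config := Config {
  agents : 'I_k -> option agent;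
  pebbles : 'I_n -> nat
}.

Definition located (s : config) (a : 'I_k) (v : 'I_n) : bool :=
  if agents s a is Some x then loc x == v else false.

Definition snapshot (s : config) (a : 'I_k) (x : agent) :
    view (agent_id k c) (bits A n) :=
  View (ids a) (mem x) (load x) (pebbles s (loc x))
       [set ids b | b : 'I_k & located s b (loc x)].

(* Destroyed agents lose the pebbles they carry. *)
Definition strike (vb : 'I_n) (h : hole_action) (s : config) : config :=
  if h is Active erase then
    Config (fun a => if located s a vb then None else agents s a)
           (fun v => if erase && (v == vb) then 0 else pebbles s v)
  else s.

Definition set_agent (s : config) (a : 'I_k) (x : agent) :=
  fun b => if b == a then Some x else agents s b.

Definition set_pebbles (s : config) (v : 'I_n) (p : nat) :=
  fun u => if u == v then p else pebbles s u.

(* The request of [a] is computed from the snapshot of [s0], and served in [s]. *)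
Definition serve (s0 s : config) (a : 'I_k) : config :=
  if agents s a is Some x then
    let p := pebbles s (loc x) in
    match communicate (snapshot s0 a x) with
    | PickUp j =>
        let q := minn j p in
        Config (set_agent s a (Agent (loc x) (mem x) (load x + q)))
               (set_pebbles s (loc x) (p - q))
    | Drop j =>
        let q := minn j (load x) in
        Config (set_agent s a (Agent (loc x) (mem x) (load x - q)))
               (set_pebbles s (loc x) (p + q))
    end
  else s.

(* Mutual exclusion: the agents are served one after the other, in the order
   [o 0, o 1, ...]; agents at different nodes do not interfere. *)
Definition communication_step (o : 'S_k) (s : config) : config :=
  foldl (serve s) s [seq o i | i <- enum 'I_k].

Definition neighbour (v : 'I_n) (d : move) : 'I_n :=
  match d with
  | Stay => v
  | GoLeft => ord_pred v
  | GoRight => ordS v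
  end.

(* [s0] is the configuration in which snapshots were taken, [s1] the one reached
   after communication. *)
Definition move_step (s0 s1 : config) : config :=
  Config
    (fun a => match agents s0 a, agents s1 a with
              | Some x0, Some x1 =>
                  let: (m, d) := act (snapshot s0 a x0) (load x1) in
                  Some (Agent (neighbour (loc x1) d) m (load x1))
              | _, _ => None
              end)
    (pebbles s1).

Definition round (vb : 'I_n) (h : hole_action) (o : 'S_k) (s : config) : config :=
  let s0 := strike vb h s in move_step s0 (communication_step o s0).

Definition initial (start : 'I_k -> 'I_n) : config :=
  Config (fun a => Some (Agent (start a) (init_memory A n) 1)) (fun=> 0).

Fixpoint run (start : 'I_k -> 'I_n) (vb : 'I_n) (adv : nat -> hole_action)
    (order : nat -> 'S_k) (t : nat) : config :=
  if t is t'.+1 then round vb (adv t') (order t') (run start vb adv order t')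
  else initial start.

Definition perpetually_explored (start : 'I_k -> 'I_n) (vb : 'I_n)
    (adv : nat -> hole_action) (order : nat -> 'S_k) : Prop :=
  forall v : 'I_n, v != vb -> forall T : nat, exists t : nat,
    T <= t /\ exists a : 'I_k, located (run start vb adv order t) a v.

End Execution.

Definition scattered (k n : nat) (start : 'I_k -> 'I_n) : Prop :=
  exists a b : 'I_k, start a != start b.

(* Since the algorithm and the service order are deterministic, the adversary,
   who knows them, may as well fix its whole behaviour in advance. *)
Definition solves_PerpExploration_BBH (k c : nat) (ids : 'I_k -> agent_id k c)
    (order : nat -> 'S_k) (A : algorithm k c) : Prop :=
  forall n : nat, 3 <= n ->
  forall (start : 'I_k -> 'I_n) (vb : 'I_n) (adv : nat -> hole_action),
    scattered start -> (forall a, start a != vb) ->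
    perpetually_explored A ids start vb adv order.

(* Main.v *)
Require Import Defs.
From Stdlib Require Import FunctionalExtensionality.
From mathcomp Require Import all_boot all_fingroup zify.

(** On the ring of 33 nodes let every agent start in the middle of its own arc of
    11 nodes, and let the hole sleep until some agent X first reaches an end of
    its arc. Until then X has interacted with nobody, so destroying X earlier
    leaves the others unaware of it, and the only trace is the pebble of X.
    If that pebble has travelled far towards the end reached, X carried it
    through three consecutive nodes, and destroying X on any of them leaves no
    pebble at all; otherwise X has visited three consecutive nodes beyond its
    pebble, and destroying X on any of them leaves the pebble at the same place.
    Hence there are three consecutive suspects u, v, w which the two survivors
    cannot tell apart. When a survivor later enters v, say from u, the adversary
    may have destroyed it on u or on v. The last agent cannot tell which, and
    must enter one of the two nodes. *)

Set Implicit Arguments.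
Unset Strict Implicit.
Unset Printing Implicit Defensive.

(** * Locality of a single round *)

Section Rounds.

Context {k c : nat} {A : algorithm k c} {ids : 'I_k -> agent_id k c} {n : nat}.
Implicit Types (s : config A n) (D : pred 'I_n) (o : 'S_k).

Definition place s a : option 'I_n := omap (@loc _ _ _ _) (agents s a).

Lemma locatedE s a v : located s a v = (place s a == Some v).
Proof. by rewrite /located /place; case: (agents s a). Qed.

Definition within D (p : option 'I_n) : bool := if p is Some v then D v else false.

(** The disjunction rules out an agent that stands in [D] in only one of the configurations, since
    the agents in [D] could see it there. *)
Definition agree D s s' : Prop :=
  (forall v, D v -> pebbles s v = pebbles s' v) /\
  (forall a, agents s a = agents s' a \/
     ~~ within D (place s a) /\ ~~ within D (place s' a)).

Definition advance o s := move_step ids s (communication_step ids o s).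

Lemma config_ext s s' :
  agents s =1 agents s' -> pebbles s =1 pebbles s' -> s = s'.
Proof.
case: s s' => [f p] [f' p'] /= ef ep.
by rewrite (functional_extensionality _ _ ef) (functional_extensionality _ _ ep).
Qed.

Lemma serve_spec s0 s a x : agents s a = Some x ->
  exists (l p : nat), serve ids s0 s a =
      Config (set_agent s a (Agent (loc x) (Defs.mem x) l)) (set_pebbles s (loc x) p) /\
    l + p = load x + pebbles s (loc x).
Proof.
rewrite /serve => ->.
by case: communicate => j; refine (ex_intro _ _ (ex_intro _ _ (conj erefl _))); lia.
Qed.

Lemma place_serve s0 s a b : place (serve ids s0 s a) b = place s b.
Proof.
case E: (agents s a) => [x|]; last by rewrite /serve E.
have [l [p [-> _]]] := serve_spec s0 E.
by rewrite /place /= /set_agent; case: eqP => // ->; rewrite E.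
Qed.

Lemma serve_other s0 s a b : b != a -> agents (serve ids s0 s a) b = agents s b.
Proof.
move=> ba; case E: (agents s a) => [x|]; last by rewrite /serve E.
have [l [p [-> _]]] := serve_spec s0 E.
by rewrite /= /set_agent (negPf ba).
Qed.

Lemma serve_pebbles s0 s a v :
  place s a != Some v -> pebbles (serve ids s0 s a) v = pebbles s v.
Proof.
case E: (agents s a) => [x|]; last by rewrite /serve E.
have [l [p [-> _]]] := serve_spec s0 E.
rewrite /place E /= /set_pebbles => h; case: (altP (v =P loc x)) => // e.
by rewrite e eqxx in h.
Qed.

Lemma agree_snapshot D s s' a x :
  agree D s s' -> D (loc x) -> snapshot ids s a x = snapshot ids s' a x.
Proof.
move=> [Hp Ha] Dx; rewrite /snapshot Hp //; congr View.
have e b : located s b (loc x) = located s' b (loc x).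
  rewrite !locatedE; case: (Ha b) => [e|[]]; first by rewrite /place e.
  have F t : ~~ within D (place t b) -> (place t b == Some (loc x)) = false.
    by move=> h; apply/negP => /eqP e; rewrite e /= Dx in h.
  by move=> /F -> /F ->.
by apply/setP => i; apply/imsetP/imsetP => -[b]; rewrite !inE => hb ->;
   exists b; rewrite // inE ?e // -e.
Qed.

Lemma agree_serve D s0 s0' s s' a : agree D s0 s0' -> agree D s s' ->
  agree D (serve ids s0 s a) (serve ids s0' s' a).
Proof.
move=> H0 [Hp Ha].
have out t0 t u : ~~ within D (place t a) -> D u ->
    pebbles (serve ids t0 t a) u = pebbles t u.
  move=> h Du; apply: serve_pebbles; apply: contraNneq h => -> /=.
  by [].
have [[w w']|[e w]] :
    (~~ within D (place s a) /\ ~~ within D (place s' a)) \/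
    (agents s a = agents s' a /\ within D (place s a)).
- case: (Ha a) => [e|]; last by left.
  case: (boolP (within D (place s a))) => w; first by right.
  by left; split=> //; rewrite /place -e.
- split=> [v Dv|b]; first by rewrite !out // Hp.
  rewrite !place_serve; case: (altP (b =P a)) => [->|ba]; first by right.
  by rewrite !serve_other.
move: w; rewrite /place; case E: (agents s a) => [x|] //= Dx.
have E' : agents s' a = Some x by rewrite -e.
rewrite /serve E E' (agree_snapshot a H0 Dx) (Hp _ Dx).
by case: communicate => j; split=> [v Dv|b] /=;
   rewrite /set_pebbles /set_agent /place /= /set_agent; case: eqP => // _;
   solve [exact: Hp | by left | exact: Ha].
Qed.

Lemma agree_communication D o s s' : agree D s s' ->
  agree D (communication_step ids o s) (communication_step ids o s').
Proof.
rewrite /communication_step => H0.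
set l := [seq _ | i <- _].
suff: forall t t', agree D t t' ->
  agree D (foldl (serve ids s) t l) (foldl (serve ids s') t' l) by apply.
elim: l => //= a l IH t t' H.
by apply: IH; apply: agree_serve.
Qed.

Lemma place_communication o s a : place (communication_step ids o s) a = place s a.
Proof.
rewrite /communication_step; set l := [seq _ | i <- _].
suff: forall t, place (foldl (serve ids s) t l) a = place t a by apply.
by elim: l => //= b l IH t; rewrite IH place_serve.
Qed.

Lemma pebbles_unvisited o s v : (forall a, place s a != Some v) ->
  pebbles (advance o s) v = pebbles s v.
Proof.
rewrite /advance /= /communication_step; set l := [seq _ | i <- _].
suff: forall t, (forall a, place t a != Some v) ->
  pebbles (foldl (serve ids s) t l) v = pebbles t v by apply.
elim: l => //= b l IH t ht.
by rewrite IH ?serve_pebbles // => a; rewrite place_serve.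
Qed.

Lemma advance_dead o s a : agents s a = None -> agents (advance o s) a = None.
Proof. by rewrite /advance /= => ->. Qed.

(** Requests act on the node occupied before the move, so the pebbles agree on all of [D]
    afterwards. An agent entering [D] from outside may differ, so [agree] itself need not
    survive. *)
Lemma agree_advance D o s s' : agree D s s' ->
  (forall v, D v -> pebbles (advance o s) v = pebbles (advance o s') v) /\
  (forall a, within D (place s a) -> agents s a = agents s' a ->
     agents (advance o s) a = agents (advance o s') a).
Proof.
move=> H; have [Hp Ha] := agree_communication o H; split=> // a.
rewrite /advance /=; case: (Ha a) => [->|[]]; last by rewrite place_communication => /negPf ->.
rewrite /place; case: (agents s a) => [x|] //= Dx <-.
by case: (agents _ a) => // y; rewrite (agree_snapshot a H).
Qed.

Lemma advance_solo o s a x : agents s a = Some x ->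
  (forall b, b != a -> place s b != Some (loc x)) ->
  exists x' d, [/\ agents (advance o s) a = Some x',
    loc x' = neighbour (loc x) d &
    load x' + pebbles (advance o s) (loc x) = load x + pebbles s (loc x)].
Proof.
move=> E solo.
have [y [Ey ly ty]] : exists y, [/\ agents (communication_step ids o s) a = Some y,
    loc y = loc x & load y + pebbles (communication_step ids o s) (loc x) =
    load x + pebbles s (loc x)].
  rewrite /communication_step; set l := [seq _ | i <- _].
  set total := load x + _.
  suff: forall t, (forall b, b != a -> place t b != Some (loc x)) ->
      (exists y, [/\ agents t a = Some y, loc y = loc x &
         load y + pebbles t (loc x) = total]) ->
      exists y, [/\ agents (foldl (serve ids s) t l) a = Some y, loc y = loc x &
         load y + pebbles (foldl (serve ids s) t l) (loc x) = total].
    by apply=> //; exists x.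
  elim: l => //= b l IH t ht [y [Ey ly ty]].
  apply: IH => [b' /ht|]; first by rewrite place_serve.
  case: (altP (b =P a)) => [->|ba].
    have [l1 [p [-> e]]] := serve_spec s Ey.
    rewrite /= /set_agent /set_pebbles ly !eqxx; eexists; split; [by []|by []|].
    by rewrite /= e ly.
  by rewrite serve_other 1?eq_sym // serve_pebbles ?ht //; exists y.
rewrite /advance /= E Ey. case: Defs.act => m d.
by exists (Agent (neighbour (loc y) d) m (load y)), d; rewrite /= ly.
Qed.

Lemma advance_moves o s a x : agents s a = Some x ->
  exists x' d, agents (advance o s) a = Some x' /\ loc x' = neighbour (loc x) d.
Proof.
move=> E; have := place_communication o s a.
rewrite /place E /advance /= E; case: (agents _ a) => //= y [ly].
case: Defs.act => m d; exists (Agent (neighbour (loc y) d) m (load y)), d.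
by rewrite /= ly.
Qed.

Lemma strike_place vb b s a :
  agents (strike vb (Active b) s) a =
  if place s a == Some vb then None else agents s a.
Proof. by rewrite /= locatedE. Qed.


(** * Executions and indistinguishable holes *)

Context {start : 'I_k -> 'I_n} {order : nat -> 'S_k}.

(* Configurations in the middle of round [t], between the strike of the hole [vb]
   and the communication step; so striking again keeps [t]. *)
Inductive reach (vb : 'I_n) : nat -> config A n -> Prop :=
| reach_initial : reach vb 0 (initial A start)
| reach_strike t s : reach vb t s -> reach vb t (strike vb (Active false) s)
| reach_advance t s : reach vb t s -> reach vb t.+1 (advance (order t) s).

Fixpoint free_run t r s :=
  if r is r'.+1 then free_run t.+1 r' (advance (order t) s) else s.

(** [reach] allows several strikes in one round while [run] has one action per round; two strikes at
    the same node merge into one. *)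
Lemma strike_strike vb h s :
  exists h', strike vb (Active false) (strike vb h s) = strike vb h' s.
Proof.
case: h => [|b]; first by exists (Active false).
exists (Active b); apply: config_ext => v //=.
rewrite /located /=; case E: (agents s v) => [x|] //.
by case: (boolP (loc x == vb)) => // /negPf ->.
Qed.

Lemma eq_run vb adv adv' t : (forall i, i < t -> adv i = adv' i) ->
  run A ids start vb adv order t = run A ids start vb adv' order t.
Proof.
elim: t => //= t IH H; rewrite IH ?H // => i it.
by apply: H; apply: ltnW.
Qed.

Lemma reach_run vb t s : reach vb t s ->
  exists adv h, s = strike vb h (run A ids start vb adv order t).
Proof.
elim=> {t s} [|t s _ [adv [h ->]]|t s _ [adv [h ->]]].
- by exists (fun=> Inactive), Inactive.
- by have [h' ->] := strike_strike vb h (run A ids start vb adv order t); exists adv, h'.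
(* The pending strike [h] becomes the action of round [t] once that round is completed. *)
- exists (fun i => if i == t then h else adv i), Inactive.
  rewrite /= eqxx; rewrite (@eq_run _ _ adv) // => i it.
  by rewrite ltn_eqF.
Qed.

Lemma run_free vb adv t r : (forall i, t <= i -> adv i = Inactive) ->
  run A ids start vb adv order (t + r) =
  free_run t r (run A ids start vb adv order t).
Proof.
elim: r t => [|r IH] t H; first by rewrite addn0.
rewrite addnS -addSn IH /= ?H // => i it.
by apply: H; apply: ltnW.
Qed.

Lemma free_run_dead t r s a : agents s a = None -> agents (free_run t r s) a = None.
Proof. by elim: r t s => //= r IH t s E; apply/IH/advance_dead. Qed.

Hypothesis explored : forall vb adv, (forall a, start a != vb) ->
  perpetually_explored A ids start vb adv order.

Lemma reach_visits vb t s v : (forall a, start a != vb) -> reach vb t s -> v != vb ->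
  exists r a, place (free_run t r s) a = Some v.
Proof.
move=> ok /reach_run [adv [h ->]] vvb.
(* Replay the history of [s], then let the hole sleep forever. Visits are demanded from [t.+1] on
   because [s] already lies inside round [t]. *)
pose adv' i := if i < t then adv i else if i == t then h else Inactive.
have [i [ti [a]]] := explored adv' ok vvb t.+1.
rewrite locatedE => /eqP la; exists (i - t), a; move: la.
have -> : i - t = (i - t.+1).+1 by lia.
have {1}-> : i = t.+1 + (i - t.+1) by lia.
rewrite run_free; last by move=> j tj; rewrite /adv' ltnNge ltnW // gtn_eqF.
have -> : run A ids start vb adv' order t.+1 =
    advance (order t) (strike vb h (run A ids start vb adv order t)).
  rewrite /= (@eq_run _ _ adv) => [|j jt]; last by rewrite /adv' jt.
  by rewrite /adv' ltnn eqxx.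
by [].
Qed.

Lemma some_alive vb t s v : (forall a, start a != vb) -> reach vb t s -> v != vb ->
  ~ (forall a, agents s a = None).
Proof.
move=> ok R vvb dead; have [r [a]] := reach_visits ok R vvb.
by rewrite /place free_run_dead.
Qed.

(* A lone agent that cannot tell whether the hole is [u] or [v] dies on the
   first of these nodes it enters. *)
Lemma lone_agent u v t s s' b :
  (forall a, start a != u) -> (forall a, start a != v) -> u != v ->
  reach u t s -> reach v t s' ->
  (forall a, a != b -> agents s a = None) ->
  agents s =1 agents s' ->
  (forall x, x != u -> pebbles s x = pebbles s' x) -> False.
Proof.
move=> oku okv uv Ru Rv dead Ea Ep.
have vu : v != u by rewrite eq_sym.
have [r [a]] := reach_visits oku Ru vu.
elim: r t s s' Ru Rv dead Ea Ep => [|r IH] t s s' Ru Rv dead Ea Ep.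
  move=> /= av.
  have ab : a = b.
    by apply/eqP; apply: contraT => /dead; move: av; rewrite /place; case: agents.
  apply: (some_alive okv (reach_strike Rv) uv) => d.
  rewrite strike_place /place -Ea; case: (altP (d =P b)) => [->|/dead -> //].
  by rewrite -ab -/(place s a) av eqxx.
(* On [u], a hole at [u] destroys [b]. Elsewhere [b] sees the same in both worlds, which differ at
   most in the pebbles on [u]. *)
case: (altP (place s b =P Some u)) => bu.
  case: (some_alive oku (reach_strike Ru) vu) => d.
  by rewrite strike_place; case: (altP (d =P b)) => [->|/dead ->];
     rewrite ?bu ?eqxx //; case: ifP.
have H : agree [pred x | x != u] s s' by split=> // d; left.
have [Hp Ha] := agree_advance (order t) H.
apply: IH (reach_advance Ru) (reach_advance Rv) _ _ _ => // [d /dead/advance_dead //|d].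
case: (altP (d =P b)) => [->|/dead E]; last first.
  by rewrite !advance_dead // -Ea.
case E : (agents s b) => [x|]; last by rewrite !advance_dead // -Ea.
by apply: Ha => //; move: bu; rewrite /place E /= (inj_eq Some_inj).
Qed.

(** A hole at [u] destroys [a] before its move, a hole at [v] after it. The survivor [b] is in the
    same state either way; only the pebbles on [u] can differ, because [a] may have handled them
    before moving. Then [lone_agent] applies. *)
Lemma pair_fails u v t s a b :
  (forall d, start d != u) -> (forall d, start d != v) -> u != v ->
  reach u t s -> reach v t s ->
  (forall d, d != a -> d != b -> agents s d = None) ->
  place s a = Some u -> place (advance (order t) s) a = Some v -> False.
Proof.
move=> oku okv uv Ru Rv dead au av.
have vu : v != u by rewrite eq_sym.
set s1 := strike u (Active false) s.
have H : agree [pred x | x != u] s s1.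
  split=> // d; rewrite strike_place; case: eqP => [e|_]; last by left.
  right; rewrite /place strike_place /= e eqxx; split=> //.
  by rewrite -/(place s d) e /= eqxx.
have a1 : agents s1 a = None by rewrite strike_place au eqxx.
have dead1 d : d != b -> agents s1 d = None.
  case: (altP (d =P a)) => [-> //|da db].
  by rewrite strike_place dead //; case: ifP.
(* If [b] shared [u] with [a], one strike would destroy both; likewise for [v] after the move. *)
have b1 : place s b <> Some u.
  move=> bu; apply: (some_alive oku (reach_strike Ru) vu) => d.
  case: (altP (d =P b)) => [->|/dead1 //].
  by rewrite strike_place bu eqxx.
have [Hp Ha] := agree_advance (order t) H.
set s2 := advance (order t) s in av Hp Ha.
have dead2 d : d != a -> d != b -> agents s2 d = None.
  by move=> da db; apply/advance_dead/dead.
have b2 : place s2 b <> Some v.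
  move=> bv; apply: (some_alive okv (reach_strike (reach_advance Rv)) uv) => d.
  rewrite strike_place -/s2.
  case: (altP (d =P a)) => [->|da]; first by rewrite av eqxx.
  case: (altP (d =P b)) => [->|db]; first by rewrite bv eqxx.
  by rewrite dead2 //; case: ifP.
apply: (lone_agent (b := b) oku okv uv (reach_advance (reach_strike Ru))
          (reach_strike (reach_advance Rv))) => [d db|d|x xu].
- exact/advance_dead/dead1.
- rewrite strike_place -/s2 -/s1.
  case: (altP (d =P a)) => [->|da]; first by rewrite advance_dead // av eqxx.
  case: (altP (d =P b)) => [->|db]; last first.
    by rewrite advance_dead ?dead1 // dead2 //; case: ifP.
  rewrite ifN; last exact/eqP.
  have sb : agents s1 b = agents s b by rewrite strike_place ifN //; exact/eqP.
  case E : (agents s b) => [x|]; last by rewrite /s2 !advance_dead // sb.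
  symmetry; apply: Ha => //; move: b1; rewrite /place E /= => b1.
  by apply/eqP => e; apply: b1; rewrite e.
- by rewrite -Hp.
Qed.

(* An agent enters [v] from [u] or [w], and the adversary may have destroyed it
   on either end of that move. *)
Lemma two_agents_fail u v w t s :
  (forall x d, neighbour x d = v -> [|| x == u, x == v | x == w]) ->
  (forall a, [/\ start a != u, start a != v & start a != w]) ->
  u != v -> w != v ->
  reach u t s -> reach v t s -> reach w t s ->
  (forall a, agents s a <> None ->
     exists b, forall d, d != a -> d != b -> agents s d = None) ->
  (forall a, place s a != Some v) -> False.
Proof.
move=> nb ok uv wv Ru Rv Rw two away.
have oku a : start a != u by case: (ok a).
have okv a : start a != v by case: (ok a).
have okw a : start a != w by case: (ok a).
have [|r [a]] := reach_visits oku Ru (v := v); first by rewrite eq_sym.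
elim: r t s Ru Rv Rw two away => [|r IH] t s Ru Rv Rw two away.
  by move=> /= /eqP; rewrite (negPf (away a)).
(* While nobody enters [v], the hole sleeps and all hypotheses carry over; the first entry is left
   to [pair_fails]. *)
case: (boolP [forall b, place (advance (order t) s) b != Some v]) => [/forallP away'|].
  apply: IH => //; try exact: reach_advance.
  move=> b b1; have [|b' Hb'] := two b; first by move=> /(advance_dead (order t)).
  by exists b' => d da db; apply: advance_dead (Hb' d da db).
rewrite negb_forall => /existsP [b]; rewrite negbK => /eqP bv _.
case E: (agents s b) => [x|]; last by move: bv; rewrite /place advance_dead.
have [b' Hb'] : exists b', forall d, d != b -> d != b' -> agents s d = None.
  by apply: two; rewrite E.
have bx : place s b = Some (loc x) by rewrite /place E.
have [x' [d [E' lx']]] := advance_moves (order t) E.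
have /nb /or3P [] : neighbour (loc x) d = v.
- by move: bv; rewrite /place E' /= -lx' => -[].
- by move=> /eqP xu; apply: (pair_fails oku okv uv Ru Rv Hb' _ bv); rewrite bx xu.
- by move=> /eqP xv; move: (away b); rewrite bx xv eqxx.
- by move=> /eqP xw; apply: (pair_fails okw okv wv Rw Rv Hb' _ bv); rewrite bx xw.
Qed.

End Rounds.

(** * Three arcs of 11 nodes and the undisturbed run *)

Section ThreeArcs.

Context {c : nat} {A : algorithm 3 c} {ids : 'I_3 -> agent_id 3 c}.
Context {order : nat -> 'S_3}.
Implicit Types (X : 'I_3) (v z q : 'I_33) (s : config A 33).

Definition arc X v : bool := v %/ 11 == X.
Definition home X : 'I_33 := inord (11 * X + 5).

Local Notation advance := (advance (ids := ids)).
Local Notation reach := (reach (A := A) (ids := ids) (start := home) (order := order)).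
Local Notation free_run := (free_run (A := A) (ids := ids) (order := order)).

Lemma homeE X : home X = 11 * X + 5 :> nat.
Proof. by rewrite /home inordK //; have := ltn_ord X; lia. Qed.

Lemma neighbour_near v d : 0 < v < 32 -> v.-1 <= neighbour v d <= v.+1.
Proof. by case: d => /= h; have := ltn_ord v; lia. Qed.

Lemma neighbour_inv v d (m : nat) : 0 < m < 32 -> neighbour v d = m :> nat ->
  m.-1 <= v <= m.+1.
Proof. by case: d => /= h; have := ltn_ord v; lia. Qed.

Fixpoint quiet t : config A 33 :=
  if t is t'.+1 then advance (order t') (quiet t') else initial A home.

(** As long as the hole has not acted, it may be anywhere. *)
Lemma reach_quiet v t : reach v t (quiet t).
Proof. by elim: t => [|t IH] /=; [exact: reach_initial | exact: reach_advance]. Qed.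

Definition at_home t : Prop := forall X, exists2 x, agents (quiet t) X = Some x &
  arc X (loc x).

(** Both ends of the arc are excluded, so that one more move cannot leave it. *)
Definition inside t : Prop := forall X, exists2 x, agents (quiet t) X = Some x &
  11 * X < loc x < 11 * X + 10.

Lemma inside_at_home t : inside t -> at_home t.
Proof. by move=> H X; have [x E h] := H X; exists x => //; rewrite /arc; lia. Qed.

Lemma inside_next t : inside t -> at_home t.+1.
Proof.
move=> H X; have [x E h] := H X.
have [x' [d [E' lx']]] := advance_moves (ids := ids) (order t) E.
exists x' => //; rewrite lx' /arc.
have := @neighbour_near (loc x) d; have := ltn_ord X; lia.
Qed.

Lemma at_home_away t X a v : at_home t -> a != X -> arc X v ->
  place (quiet t) a != Some v.
Proof.
move=> H aX Xv; have [x E h] := H a; rewrite /place E /=.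
apply: contraNneq aX => -[e]; apply/eqP/val_inj => /=.
by move: Xv h; rewrite /arc -e => /eqP -> /eqP.
Qed.

(* In round [t], just after the hole [v] has struck: [X] has been destroyed at
   [v], leaving the pebbles [P] on its arc, and the rest of the ring is as in the
   undisturbed run. *)
Definition killed X (P : 'I_33 -> nat) t v : Prop :=
  exists s, [/\ reach v t s, agents s X = None,
    forall a, a != X -> agents s a = agents (quiet t) a &
    forall z, pebbles s z = if arc X z then P z else pebbles (quiet t) z].

Lemma kill X P t x : at_home t -> agents (quiet t) X = Some x ->
  (forall z, arc X z -> pebbles (quiet t) z = P z) -> killed X P t (loc x).
Proof.
move=> H E HP; exists (strike (loc x) (Active false) (quiet t)); split.
- exact/reach_strike/reach_quiet.
- by rewrite strike_place /place E eqxx.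
- move=> a aX; rewrite strike_place ifN //; apply: at_home_away aX _ => //.
  by have [y] := H X; rewrite E => -[->].
- by move=> z /=; case: ifP => // /HP.
Qed.

(** Nobody else stands on the arc of [X], so its pebbles stay put, and the absence of [X] changes
    nothing that the agents on the other arcs see. *)
Lemma killed_next X P t v : inside t -> killed X P t v -> killed X P t.+1 v.
Proof.
move=> H [s [R EX Ea Ep]].
have hm := inside_at_home H.
have others a z : a != X -> arc X z -> place s a != Some z.
  by move=> aX Xz; rewrite /place Ea //; apply: at_home_away aX Xz.
have ag : agree [pred z | ~~ arc X z] s (quiet t).
  split=> [z /negPf Xz|a]; first by rewrite Ep Xz.
  case: (altP (a =P X)) => [->|/Ea ->]; last by left.
  right; rewrite /place EX; split=> //.
  by have [x -> /= ->] := hm X.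
have [Hp Ha] := agree_advance (ids := ids) (order t) ag.
exists (advance (order t) s); split.
- exact: reach_advance.
- exact: advance_dead.
- move=> a aX; apply: Ha; last exact: Ea.
  have [x E h] := hm a; rewrite /place Ea // E /=; apply: contraNN aX => h'.
  by apply/eqP/val_inj => /=; move: h' h; rewrite /arc => /eqP -> /eqP.
- move=> z; case: ifP => [Xz|/negbT /Hp //].
  rewrite pebbles_unvisited ?Ep ?Xz // => a.
  case: (altP (a =P X)) => [->|aX]; first by rewrite /place EX.
  exact: others.
Qed.

(* [q] is the node of the pebble of [X], carried or not. *)
Definition tracked t X : Prop := exists x q,
  [/\ agents (quiet t) X = Some x, arc X (loc x), arc X q,
      load x = 1 /\ loc x = q \/ load x = 0 &
      forall z, arc X z -> pebbles (quiet t) z = (load x == 0) && (z == q)] /\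
  ((forall v, (11 * X + 5 < v <= q) || (q <= v < 11 * X + 5) ->
     killed X (fun=> 0) t v) /\
  (load x = 0 -> forall v, (q < v <= loc x) || (loc x <= v < q) ->
     killed X (fun z => z == q) t v)).

Lemma tracked_at_home t : (forall X, tracked t X) -> at_home t.
Proof. by move=> H X; have [x [q [[E h _ _ _] _]]] := H X; exists x. Qed.

Lemma tracked0 X : tracked 0 X.
Proof.
have h := homeE X.
exists (Agent (home X) (init_memory A 33) 1), (home X); split; first split=> //=.
- by rewrite /arc h; lia.
- by rewrite /arc h; lia.
- by left.
- by split=> //= v; rewrite h; lia.
Qed.

(** The only suspect that can be new is the node [X] has just entered: if [X] carries the pebble, a
    strike there leaves none on the arc, otherwise the pebble stays at [q]. Older suspects persist
    by [killed_next]. *)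
Lemma tracked_next t : inside t -> (forall X, tracked t X) ->
  forall X, tracked t.+1 X.
Proof.
move=> ins tr X; have hm := inside_at_home ins; have hm' := inside_next ins.
have [x [q [[E Xx Xq ld pb] [c1 c2]]]] := tr X.
have [x0] := ins X; rewrite E => -[<- {x0}] bx.
have [b bX|x' [d [E' lx' tot]]] := advance_solo (ids := ids) (order t) E.
  exact: at_home_away bX Xx.
have Xx' : arc X (loc x') by have [y] := hm' X; rewrite [agents _ _]E' => -[<-].
have near : (loc x).-1 <= loc x' <= (loc x).+1.
  by rewrite lx'; apply: neighbour_near; have := ltn_ord X; lia.
have away z : arc X z -> z != loc x ->
    pebbles (quiet t.+1) z = pebbles (quiet t) z.
  move=> Xz zx; apply: pebbles_unvisited => a.
  case: (altP (a =P X)) => [->|aX]; last exact: at_home_away aX Xz.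
  by rewrite /place E /=; apply: contraNneq zx => -[->].
have c1' v : (11 * X + 5 < v <= q) || (q <= v < 11 * X + 5) ->
    killed X (fun=> 0) t.+1 v.
  by move=> /c1 /(killed_next ins).
(* By conservation of its single pebble, [X] either ends the round carrying it, which forces
   [q = loc x], or leaves it lying at [q]. *)
have [[l1 [qx p0]]|[l0 pq]] :
    (load x' = 1 /\ q = loc x /\ forall z, arc X z -> pebbles (quiet t.+1) z = 0) \/
    (load x' = 0 /\ forall z, arc X z -> pebbles (quiet t.+1) z = (z == q)).
- move: tot; rewrite pb //; case: (altP (loc x =P q)) => xq tot.
    have {}tot : load x' + pebbles (quiet t.+1) (loc x) = 1.
      by rewrite [LHS]tot; case: ld => [[-> _]|->].
    case l : (load x') tot => [|l'] tot.
      right; split=> // z Xz; case: (altP (z =P q)) => [->|zq].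
        by rewrite -xq.
      rewrite away ?xq // pb // (negPf zq) andbF.
      by [].
    left; split; first by lia.
    split=> // z Xz; case: (altP (z =P loc x)) => [->|zx]; first by lia.
    by rewrite away // pb // -xq (negPf zx) andbF.
  have l0 : load x = 0 by case: ld => // -[_ e]; rewrite e eqxx in xq.
  move: tot; rewrite l0 /= => tot.
  right; split; first by lia.
  move=> z Xz; case: (altP (z =P loc x)) => [->|zx].
    by rewrite (negPf xq); lia.
  by rewrite away // pb // l0.
- exists x', (loc x'); split; first split=> //; first by left.
    by move=> z /p0 ->; rewrite l1.
  split; last by rewrite l1.
  move=> v hv; case: (altP (v =P loc x')) => [->|/eqP vx].
    exact: kill.
  apply: c1'; rewrite qx.
  have : nat_of_ord v <> loc x' by move=> e; apply/vx/val_inj.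
  lia.
- exists x', q; split; first split=> //; first by right.
    by move=> z /pq ->; rewrite l0.
  split=> // _ v hv; case: (altP (v =P loc x')) => [->|/eqP vx].
    exact: kill.
  have {vx} : nat_of_ord v <> loc x' by move=> e; apply/vx/val_inj.
  (* A pebble dropped in this round lies at most one step from [X], so [loc x'] is then the only
     candidate. *)
  case: ld => [[_ xq]|l] vx; first by rewrite xq in near; lia.
  by apply: (killed_next ins); apply: c2 => //; lia.
Qed.

(** * No agent ever reaches an end of its arc *)

Hypothesis explored : forall vb adv, (forall a, home a != vb) ->
  perpetually_explored A ids home vb adv order.

(** [killed] determines the whole configuration, so the survivors face the same one for all three
    positions of the hole. The bounds on [m] keep these nodes on the arc, on one side of the home of
    [X]. *)
Lemma three_suspects_fail X P t (m : nat) : at_home t ->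
  11 * X < m < 11 * X + 10 -> m.+1 < 11 * X + 5 \/ 11 * X + 5 < m.-1 ->
  (forall v, m.-1 <= v <= m.+1 -> killed X P t v) -> False.
Proof.
move=> hm bm hX H; have X3 := ltn_ord X.
pose u : 'I_33 := inord m.-1; pose v : 'I_33 := inord m; pose w : 'I_33 := inord m.+1.
have eu : u = m.-1 :> nat by rewrite inordK //; lia.
have ev : v = m :> nat by rewrite inordK //; lia.
have ew : w = m.+1 :> nat by rewrite inordK //; lia.
have [|s [Ru dX Ea Ep]] := H u; first by lia.
have same z : killed X P t z -> reach z t s.
  case=> s' [R dX' Ea' Ep']; suff -> : s = s' by [].
  apply: config_ext => [a|y]; last by rewrite Ep Ep'.
  case: (altP (a =P X)) => [->|aX]; first by rewrite dX dX'.
  by rewrite Ea // Ea'.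
have hne a z : m.-1 <= z <= m.+1 -> home a != z.
  move=> hz; apply/eqP => /(congr1 (@nat_of_ord 33)); rewrite homeE; lia.
apply: (two_agents_fail (u := u) (v := v) (w := w) (s := s) (t := t) explored).
- move=> x d /(congr1 (@nat_of_ord 33)); rewrite ev => /neighbour_inv hx.
  rewrite -!val_eqE /= eu ev ew; lia.
- by move=> a; split; apply: hne; lia.
- by rewrite -val_eqE /= eu ev; lia.
- by rewrite -val_eqE /= ew ev; lia.
- exact: Ru.
- by apply/same/H; lia.
- by apply/same/H; lia.
- move=> a alive; have aX : a != X by apply/eqP => e; apply: alive; rewrite e.
  (* The third index, since 0, 1 and 2 add up to 3. *)
  exists (inord (3 - a - X)) => d da db.
  suff -> : d = X by [].
  rewrite -val_eqE /= in aX; have a3 := ltn_ord a; have d3 := ltn_ord d.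
  apply/val_inj; move: da db; rewrite -!val_eqE /= inordK; lia.
- move=> a; case: (altP (a =P X)) => [->|aX]; first by rewrite /place dX.
  by rewrite /place Ea //; apply: at_home_away aX _ => //; rewrite /arc ev; lia.
Qed.

(** Pigeonhole behind the length 11: to reach an end, [X] has entered all five nodes from its home
    to that end, and [q] splits them into those up to the pebble and those beyond it. One part
    contains three consecutive nodes. *)
Lemma tracked_inside t : (forall X, tracked t X) -> inside t.
Proof.
move=> tr X; have hm := tracked_at_home tr.
have [x [q [[E Xx Xq ld _] [c1 c2]]]] := tr X.
exists x => //; case: (boolP (_ < _ < _)) => // out; exfalso.
have end_x : nat_of_ord (loc x) = 11 * X \/ nat_of_ord (loc x) = 11 * X + 10.
  by move: Xx out; rewrite /arc; lia.
have bq : 11 * X <= q <= 11 * X + 10 by move: Xq; rewrite /arc; lia.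
have l0 : nat_of_ord q <> loc x -> load x = 0 by case: ld => [[_ ->]|].
case: end_x => ex.
(* Counted from the start of the arc, the suspects are 2, 3, 4 or 0, 1, 2 here, and 6, 7, 8 or 8, 9,
   10 at the other end. *)
- case: (leqP q (11 * X + 2)) => hq.
    apply: (@three_suspects_fail X (fun=> 0) t (11 * X + 3)) => // [||v hv]; try lia.
    by apply: c1; lia.
  apply: (@three_suspects_fail X (fun z => z == q) t (11 * X + 1)) => // [||v hv]; try lia.
  by apply: c2; [apply: l0|]; lia.
- case: (leqP (11 * X + 8) q) => hq.
    apply: (@three_suspects_fail X (fun=> 0) t (11 * X + 7)) => // [||v hv]; try lia.
    by apply: c1; lia.
  apply: (@three_suspects_fail X (fun z => z == q) t (11 * X + 9)) => // [||v hv]; try lia.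
  by apply: c2; [apply: l0|]; lia.
Qed.

(** With a hole that never acts, the agents stay strictly inside their arcs, so node 0, an end of
    the first arc, is never visited. Node 1 can be the hole, being neither 0 nor a home. *)
Lemma exploration_fails : False.
Proof.
have tr t : forall X, tracked t X.
  by elim: t => [|t IH]; [exact: tracked0 | apply: tracked_next => //; apply: tracked_inside].
have ok a : home a != (inord 1 : 'I_33).
  by rewrite -val_eqE /= homeE inordK //; lia.
have [|r [a]] := reach_visits explored ok (reach_quiet (inord 1) 0) (v := ord0).
  by rewrite -val_eqE /= inordK.
have -> t : free_run t r (quiet t) = quiet (t + r).
  elim: r t => [|r IH] t /=; first by rewrite addn0.
  by rewrite -[advance _ _]/(quiet t.+1) IH addnS.
have [x E h] := tracked_inside (tr (0 + r)) a.
by rewrite /place E => -[e]; rewrite e in h.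
Qed.

End ThreeArcs.

Theorem theorem5 (c : nat) (ids : 'I_3 -> agent_id 3 c) (ids_inj : injective ids)
    (order : nat -> 'S_3) :
  ~ exists A : algorithm 3 c, solves_PerpExploration_BBH ids order A.
Proof.
move=> [A solves]; apply: (@exploration_fails c A ids order) => vb adv ok.
apply: solves => //; exists ord0, ord_max.
by rewrite -val_eqE /= !homeE.
Qed.
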